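(* For each integer $k\ge 2$ there is a positive constant $c_0(k)$, depending only on $k$, with the following property. Let $\{u_n\}_{n\ge 0}$ be an integer sequence satisfying $$u_{n+k}=a_1u_{n+k-1}+\cdots+a_{k-1}u_{n+1}+a_ku_n\qquad(n\ge 0),$$ with $a_1,\dots,a_k\in\mathbb{Z}$, $a_k\ne 0$, whose characteristic polynomial $f_u(X)=X^k-a_1X^{k-1}-\cdots-a_k$ has $k$ distinct (simple) roots $\alpha_1,\dots,\alpha_k\in\mathbb{C}$, such that in the representation $u_n=\sum_{i=1}^k A_i\alpha_i^n$ (with constants $A_i\in\mathbb{Q}(\alpha_1,\dots,\alpha_k)$) all $A_i$ are nonzero, and which is nondegenerate (i.e. $\alpha_i/\alpha_j$ is not a root of unity for $i\ne j$). Then $$\#\{n\le x:\ n\mid u_n\}\le c_0(k)\,\frac{x}{\log x}$$ for all sufficiently large $x$ (how large may depend on the sequence).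
   Context: The set $\mathcal{N}_u=\{n\ge 1: n\mid u_n\}$, and $\mathcal{N}_u(x)=\mathcal{N}_u\cap[1,x]$; the claim bounds $\#\mathcal{N}_u(x)$. *)

(* Defs.v *)
From mathcomp Require Import all_boot all_order all_algebra.
From mathcomp Require Import reals.

Set Implicit Arguments.
Unset Strict Implicit.
Unset Printing Implicit Defensive.

Import Order.TTheory GRing.Theory Num.Theory.
Local Open Scope ring_scope.

(* Coefficients are indexed as a 1, ..., a k; other values of a are unused. *)
Definition linear_recurrence (k : nat) (a : nat -> int) (u : nat -> int) :=
  forall n : nat, u (n + k)%N = \sum_(1 <= i < k.+1) a i * u (n + k - i)%N.

Definition char_poly_rec (k : nat) (a : nat -> int) : {poly int} :=
  'X^k - \sum_(1 <= i < k.+1) (a i)%:P * 'X^(k - i).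

(* z lies in every subfield of F containing all the alpha i; for F of
   characteristic zero, this is membership in Q(alpha_0, ..., alpha_(k-1)). *)
Definition in_generated_field (F : fieldType) (k : nat) (alpha : 'I_k -> F)
    (z : F) :=
  forall S : {pred F}, GRing.divring_closed S ->
    (forall i, alpha i \in S) -> z \in S.

(* m > 0 is needed: 0.-unity_root holds of every element. *)
Definition nondegenerate_roots (F : fieldType) (k : nat) (alpha : 'I_k -> F) :=
  forall i j : 'I_k, i != j ->
  forall m : nat, (0 < m)%N -> ~~ m.-unity_root (alpha i / alpha j).

Definition self_divisors (u : nat -> int) : pred nat :=
  [pred n : nat | (0 < n)%N && (n%:Z %| u n)%Z].

(* The truncation of x >= 0 is its integer part, so this counts n <= x. *)
Definition count_upto (R : realType) (N : pred nat) (x : R) : nat :=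
  count N (index_iota 0 (Num.truncn x).+1).

(* Main.v *)
Require Import Defs.
From mathcomp Require Import all_boot all_order all_algebra all_fingroup all_field.
From mathcomp Require Import complex.
From mathcomp Require Import reals exp.
From mathcomp Require mpoly.
From mathcomp Require Import zify ring lra.

(* Count the n <= x dividing u_n with weight log n, the sum of v_p(n) log p over p.
   If n = p m then p divides u_(pm), and modulo p Frobenius turns m |-> u_(pm) into
   a recurrence of order k with the p-th powers of the roots of the characteristic
   polynomial. If the first 2^l powers of these roots stay distinct modulo p, an
   elimination argument on pairs of zeros with a given difference shows that
   at most C (2 q)^l of any 2^l consecutive m are zeros, with C and q < 1 depending
   only on k; this replaces the uniform bounds for zeros of recurrences that come
   from the subspace theorem. With 2^l about min(p^(1/4), x/p), Chebyshev's bound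
   on dyadic blocks of primes makes the total weight O(x). The primes whose
   roots collide too early divide one of the integers
   N_d = prod_(i != j) (alpha_i^d - alpha_j^d), which are nonzero of size
   exp(O(d)); such primes are too sparse to matter once the primes below a bound
   depending on the sequence are discarded, and n composed mainly of the latter
   are rare. *)

Set Implicit Arguments.
Unset Strict Implicit.
Unset Printing Implicit Defensive.
Import Order.TTheory GRing.Theory Num.Theory.
Local Open Scope ring_scope.

(** * Integrality of the power discriminants *)

Module IntegralDiscriminant.
Import mpoly.

(** Ordered pairs avoid the sign that a product over i < j would acquire. *)
Lemma power_diff_prod_symmetric (k d : nat) :
  (\prod_(i < k) \prod_(j < k | j != i) ('X_i ^+ d - 'X_j ^+ d)
     : {mpoly int[k]}) \is symmetric.
Proof.
apply/issymP => s; rewrite rmorph_prod /=.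
rewrite [RHS](reindex_inj (perm_inj (s := s))) /=; apply: eq_bigr => i _.
rewrite rmorph_prod /= [RHS](reindex_inj (perm_inj (s := s))) /=.
apply: eq_big => [j|j _]; first by rewrite (inj_eq perm_inj).
have XE (l : 'I_k) : msym s ('X_l : {mpoly int[k]}) = 'X_(s l).
  rewrite msymX; congr ('X_[_]); apply/mnmP => m.
  by rewrite mnmE !mnm1E (can2_eq (permK s) (permKV s)).
by rewrite rmorphB !rmorphXn /= !XE.
Qed.

(** By the fundamental theorem of symmetric polynomials the product is an integer polynomial in the
    elementary symmetric functions of the roots, hence in the coefficients of [f]. *)
Lemma power_diff_prod_int (f : {poly int}) (k d : nat) :
  {N : int | forall (F : idomainType) (b : 'I_k -> F),
    map_poly intr f = \prod_(i < k) ('X - (b i)%:P) ->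
    N%:~R = \prod_(i < k) \prod_(j < k | j != i) (b i ^+ d - b j ^+ d)}.
Proof.
have [t [tE _]] := sym_fundamental (power_diff_prod_symmetric k d).
(* Vieta: [(-1) ^+ i.+1] times the coefficient of degree [k - i.+1] is the elementary symmetric
   function of degree [i.+1] of the roots. *)
exists (t.@[fun i : 'I_k => (-1) ^+ i.+1 * f`_(k - i.+1)]) => F b fE.
transitivity (mmap intr b
    (\prod_(i < k) \prod_(j < k | j != i) ('X_i ^+ d - 'X_j ^+ d))); last first.
  rewrite rmorph_prod; apply: eq_bigr => i _.
  rewrite rmorph_prod; apply: eq_bigr => j _.
  by rewrite rmorphB !rmorphXn /= !mmapX !mmap1U.
rewrite -tE comp_mpolyEX mevalE (raddf_sum (intr : {additive int -> F})).
rewrite (raddf_sum (mmap intr b : {additive _ -> F})) /=.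
apply: eq_bigr => m _; rewrite mmapZ intrM; congr (_ * _).
rewrite comp_mpolyX !rmorph_prod /=; apply: eq_bigr => i _.
rewrite !rmorphXn /=; congr (_ ^+ _).
rewrite tnth_mktuple rmorphM rmorphXn rmorphN rmorph1 /=.
have := mroots_coeff [tuple b i | i < k] (lift ord0 i).
rewrite big_tuple; under eq_bigr do rewrite tnth_mktuple.
rewrite -fE coef_map /= /bump leq0n add1n => ->.
rewrite mulrA -exprMn mulrNN mul1r expr1n mul1r.
rewrite /mesym !raddf_sum /=; apply/eq_bigr => h _.
rewrite !rmorph_prod /=; apply/eq_bigr => j _.
by rewrite mmapX mmap1U mevalXU tnth_mktuple.
Qed.

End IntegralDiscriminant.

(** One integer serves all domains: its size is estimated over the complex numbers, its divisibility
    by p in characteristic p. For d = 1 it is the discriminant of [f] up to sign. *)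
Definition power_discriminants (f : {poly int}) (k : nat) (N : nat -> int) : Prop :=
  forall d (F : idomainType) (b : 'I_k -> F),
    map_poly intr f = \prod_(i < k) ('X - (b i)%:P) ->
    (N d)%:~R = \prod_(i < k) \prod_(j < k | j != i) (b i ^+ d - b j ^+ d).

(** * Zeros of power sums *)

(** In the expanded square the diagonal gives the count itself; pairs n < m are grouped by m - n = d
    + 1, and letting n run over the whole range only adds terms. *)
Lemma sqr_count_le (z : pred nat) (N : nat) :
  ((\sum_(n < N) z n) ^ 2 <=
   \sum_(n < N) z n + 2 * \sum_(d < N) \sum_(n < N) (z n && z (n + d.+1)))%N.
Proof.
have -> : ((\sum_(n < N) z n) ^ 2 =
   \sum_(n < N) z n + 2 * \sum_(m < N) \sum_(n < m) (z n && z m))%N.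
  elim: N => [|N IH]; first by rewrite !big_ord0.
  rewrite !big_ord_recr /= sqrnD IH.
  have -> : (\sum_(n < N) (z n && z N) = (\sum_(n < N) z n) * z N)%N.
    by rewrite big_distrl; apply: eq_bigr => n _ /=; rewrite mulnb.
  by case: (z N) => /=; lia.
rewrite leq_add2l leq_mul2l /=.
rewrite -(big_mkord xpredT (fun m => \sum_(n < m) (z n && z m))%N).
have -> : (\sum_(0 <= m < N) \sum_(n < m) (z n && z m) =
  \sum_(0 <= m < N) \sum_(0 <= n < N | n < m) (z n && z m))%N.
  rewrite big_nat [RHS]big_nat; apply: eq_bigr => m /andP[_ mN].
  by rewrite -(big_mkord xpredT (fun n => (z n && z m) : nat)) (big_nat_widen 0 m N) // ltnW.
rewrite (exchange_big_dep_nat xpredT) //= exchange_big /=.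
rewrite [leqRHS](eq_bigr
  (fun i : 'I_N => \sum_(0 <= d < N) (z i && z (i + d.+1)))%N); last first.
  by move=> i _; rewrite big_mkord.
rewrite -(big_mkord xpredT (fun i => \sum_(0 <= d < N) (z i && z (i + d.+1)))%N).
apply: leq_sum => n _.
have -> : (\sum_(0 <= m < N | n < m) (z n && z m) = \sum_(n.+1 <= m < N) (z n && z m))%N.
  by rewrite [RHS](big_nat_widenl _ 0) //; apply: eq_bigl => m.
rewrite -{1}(add0n n.+1) big_addn.
rewrite [leqRHS](big_cat_nat (n := N - n.+1)) //= ?leq_subr //.
apply: (leq_trans _ (leq_addr _ _)).
by apply: leq_sum => m _; rewrite !addnS (addnC m).
Qed.

(* A power sum is encoded by the list of the pairs (B, b) of its terms. *)
Definition power_sum (F : fieldType) (s : seq (F * F)) (n : nat) : F :=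
  \sum_(t <- s) t.1 * t.2 ^+ n.

(* With q < 1 the bound C (2 q)^l saves a power of the length 2^l; C and q are
   uniform over all fields, in particular over all characteristics. *)
Definition zeros_bounded (R : numDomainType) (C q : R) (k : nat) : Prop :=
  forall (F : fieldType) (s : seq (F * F)) (l : nat),
    (0 < size s <= k)%N ->
    all (fun t => (t.1 != 0) && (t.2 != 0)) s ->
    (forall d, (0 < d <= 2 ^ l)%N ->
       pairwise (fun t t' => t.2 ^+ d != t'.2 ^+ d) s) ->
    (\sum_(n < 2 ^ l) (power_sum s n == 0%R))%N%:R <= C * (2 * q) ^+ l.

(* If v is a power sum and b one of its bases, then v (n + d) - b ^+ d * v n has
   one term less; so few n have both v n = 0 and v (n + d) = 0, and summing over
   the differences d bounds the square of the number of zeros. *)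
Lemma power_sum_zeros (R : rcfType) (k : nat) : exists C q : R,
  [/\ 0 < C, 2^-1 <= q, q < 1 & zeros_bounded C q k].
Proof.
elim: k => [|k [C [q [C0 q2 q1 IH]]]].
  by exists 1, 2^-1; split=> //; [lra | move=> F s l; case: (size s)].
have q0 : 0 < q by lra.
have sq : Num.sqrt q ^+ 2 = q by rewrite sqr_sqrtr // ltW.
have sq0 : 0 < Num.sqrt q by rewrite sqrtr_gt0.
have s2 : 2^-1 <= Num.sqrt q.
  by rewrite leNgt; apply/negP => sh; nra.
(* The squared count is O(2^l (2 q)^l), the square of (2 sqrt q)^l, so each induction step replaces
   q by its square root. *)
exists (1 + 2 * C), (Num.sqrt q); split; first by lra.
- exact: s2.
- by rewrite -sqrtr1 ltr_sqrt.
move=> F [//|t s] l sk /= /andP[/andP[t1 t2] sN] sP.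
rewrite /= ltnS in sk.
set Y := (2 * Num.sqrt q) ^+ l.
have Y1 : 1 <= Y.
  by apply: exprn_ege1; lra.
have Y2 : Y ^+ 2 = 2 ^+ l * (2 * q) ^+ l.
  by rewrite /Y exprAC (exprMn _ 2 (Num.sqrt q)) sq -exprMn; congr (_ ^+ _); ring.
(* A single term never vanishes; the induction hypothesis excludes the empty sum that elimination
   would leave here. *)
case: s => [|t' s] in sk sN sP *.
  rewrite big1 ?mulr_ge0//; first by lra.
    by rewrite /Y exprn_ge0 // mulr_ge0 // ltW.
  by move=> n _; rewrite /power_sum big_seq1 mulf_eq0 expf_eq0 (negbTE t1) (negbTE t2) andbF.
set v := t :: t' :: s; pose z n := power_sum v n == 0.
have /(_ (2 ^ l)%N) := sqr_count_le z.
rewrite -(ler_nat R) natrX natrD natrM.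
set Z := (_)%:R => HZ.
have {HZ} HZ : Z ^+ 2 <= Z + 2 * (2 ^+ l * (C * (2 * q) ^+ l)).
  apply: (le_trans HZ); rewrite lerD2l ler_pM2l // natr_sum.
  have -> : 2 ^+ l * (C * (2 * q) ^+ l) = \sum_(d < 2 ^ l) (C * (2 * q) ^+ l).
    by rewrite sumr_const card_ord -natrX mulr_natl.
  apply: ler_sum => d _.
  (* This list encodes v (n + d + 1) - b^(d + 1) v n for the base b of [t]; distinct powers keep its
     coefficients nonzero. *)
  pose w := [seq (x.1 * (x.2 ^+ d.+1 - t.2 ^+ d.+1), x.2) | x <- t' :: s].
  have dl : (0 < d.+1 <= 2 ^ l)%N by rewrite /= ltn_ord.
  have wP := sP _ dl.
  apply: (le_trans _ (IH F w l _ _ _)).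
  - rewrite ler_nat; apply: leq_sum => n _; rewrite /z.
    case: eqP => //= v0; case: eqP => //= v1; suff -> : power_sum w n = 0 by rewrite eqxx.
    transitivity (power_sum v (n + d.+1) - t.2 ^+ d.+1 * power_sum v n).
      2: by rewrite v0 v1 mulr0 subr0.
    rewrite /power_sum /w big_map /v [in RHS]big_cons [\sum_(_ <- t :: _) _ in RHS]big_cons.
    rewrite mulrDr opprD addrACA exprD.
    rewrite (_ : t.1 * _ - _ = 0) ?add0r; last by ring.
    rewrite mulr_sumr -sumrB; apply: eq_bigr => x _ /=; rewrite exprD; ring.
  - by rewrite size_map.
  - rewrite all_map; apply/allP => x xs /=.
    move/allP: sN => /(_ x xs) /andP[x1 x2]; rewrite x2 mulf_neq0 //.
    rewrite subr_eq0 eq_sym; move: wP; rewrite pairwise_cons => /andP[/allP/(_ x xs) + _]; exact.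
  - move=> e /sP; rewrite pairwise_cons => /andP[_ H].
    by rewrite /w pairwise_map.
(* If Z > (1 + 2 C) Y, then Z - 1 >= 2 C Y because Y >= 1, and Z (Z - 1) exceeds 2 C Y^2. *)
rewrite leNgt; apply/negP => ZY.
have ZE : 2 * (2 ^+ l * (C * (2 * q) ^+ l)) = 2 * C * Y ^+ 2 by rewrite Y2; ring.
rewrite ZE in HZ.
have : (1 + 2 * C) * Y * (2 * C * Y) <= 2 * C * Y ^+ 2.
  apply: (@le_trans _ _ (Z * (Z - 1))); last by nra.
  apply: ler_pM; first by nra.
  - by nra.
  - exact: ltW.
  - by nra.
have CY : 0 < C * Y ^+ 2 by rewrite mulr_gt0 // exprn_gt0 //; lra.
by nra.
Qed.

(** * Recurrences as power sums over a field *)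

Lemma size_char_poly_rec_tail (k : nat) (a : nat -> int) :
  (size (\sum_(1 <= i < k.+1) (a i)%:P * 'X^(k - i) : {poly int})%R <= k)%N.
Proof.
rewrite big_nat; apply: (leq_trans (size_sum _ _ _)); apply/bigmax_leqP_seq => i _ ik.
apply: (leq_trans (size_polyMleq _ _)); rewrite size_polyXn addnS /=.
apply: leq_trans (leq_add (size_polyC_leq1 _) (leqnn _)) _.
case/andP: ik => i0 ik; rewrite add1n ltn_subrL i0; exact: (leq_trans i0 ik).
Qed.

Lemma char_poly_rec_monic (k : nat) (a : nat -> int) :
  (char_poly_rec k a \is monic) && (size (char_poly_rec k a) == k.+1).
Proof.
have H := size_char_poly_rec_tail k a.
rewrite /char_poly_rec monicE lead_coefDl ?size_polyDl ?size_polyN ?size_polyXn //.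
by rewrite lead_coefXn !eqxx.
Qed.

Lemma map_char_poly_rec_horner (F : comNzRingType) (k : nat) (a : nat -> int) (x : F) :
  (map_poly intr (char_poly_rec k a)).[x] =
  x ^+ k - \sum_(1 <= i < k.+1) (a i)%:~R * x ^+ (k - i).
Proof.
rewrite /char_poly_rec rmorphB /= map_polyXn hornerD hornerXn hornerN; congr (_ - _).
rewrite rmorph_sum /= horner_sum; apply: eq_bigr => i _.
by rewrite rmorphM /= map_polyXn map_polyC /= hornerCM hornerXn.
Qed.

Lemma recurrence_geometric (F : comNzRingType) (k : nat) (a : nat -> int) (x : F) (n : nat) :
  root (map_poly intr (char_poly_rec k a)) x ->
  x ^+ (n + k) = \sum_(1 <= i < k.+1) (a i)%:~R * x ^+ (n + k - i).
Proof.
move/rootP; rewrite map_char_poly_rec_horner => /eqP; rewrite subr_eq0 => /eqP xk.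
rewrite exprD xk big_nat [RHS]big_nat mulr_sumr; apply: eq_bigr => i /andP[_ ik].
by rewrite mulrCA -exprD addnBA.
Qed.

(** The constant coefficient of the polynomial is [- a k]. *)
Lemma char_poly_root_neq0 (F : fieldType) (k : nat) (a : nat -> int) (x : F) :
  (0 < k)%N -> (a k)%:~R != 0 :> F ->
  root (map_poly intr (char_poly_rec k a)) x -> x != 0.
Proof.
move=> k0 ak /rootP; rewrite map_char_poly_rec_horner => xk.
apply: contra_neq ak => x0; move: xk; rewrite x0 big_nat_recr //= big_nat big1 => [|i ik].
  by rewrite add0r subnn expr0 mulr1 expr0n eqn0Ngt k0 sub0r => /eqP; rewrite oppr_eq0 => /eqP.
by rewrite expr0n subn_eq0 leqNgt; case/andP: ik => _ ->; rewrite mulr0.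
Qed.

Lemma Vandermonde_unitmx (F : fieldType) (k : nat) (b : 'I_k -> F) :
  injective b -> Vandermonde k (\row_i b i) \in unitmx.
Proof.
move=> binj; rewrite unitmxE unitfE det_Vandermonde.
apply/prodf_neq0 => i _; apply/prodf_neq0 => j ij.
by rewrite !mxE subr_eq0 (inj_eq binj) -val_eqE /= neq_ltn ij orbT.
Qed.

(** The coefficients are fitted to the first k values through the invertible Vandermonde matrix;
    afterwards both sides obey the same recurrence. *)
Lemma recurrence_power_sum (F : fieldType) (k : nat) (a u : nat -> int) (b : 'I_k -> F) :
  linear_recurrence k a u -> injective b ->
  (forall i, root (map_poly intr (char_poly_rec k a)) (b i)) ->
  exists B : 'I_k -> F, forall n, (u n)%:~R = \sum_i B i * b i ^+ n.
Proof.
move=> ur binj broot.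
pose V := Vandermonde k (\row_i b i).
have Vu : V \in unitmx := Vandermonde_unitmx binj.
pose B := invmx V *m \col_i (u i)%:~R.
exists (fun i => B i 0) => n; have [m] := ubnP n; elim: m n => // m IH n; rewrite ltnS => nm.
have [nk|kn] := ltnP n k.
  have : (V *m B) (Ordinal nk) 0 = (u n)%:~R by rewrite mulKVmx // mxE.
  by rewrite mxE => <-; apply: eq_bigr => i _; rewrite !mxE mulrC.
rewrite -(subnK kn) ur rmorph_sum /=.
under [RHS]eq_bigr => i _ do rewrite (recurrence_geometric _ (broot i)) mulr_sumr.
rewrite exchange_big /= big_nat [RHS]big_nat; apply: eq_bigr => i /andP[i0 ik].
rewrite rmorphM /= IH; last by lia.
by rewrite mulr_sumr; apply: eq_bigr => j _; rewrite mulrCA.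
Qed.

(* In an algebraic closure of F_p, u n is a power sum over the roots b of the
   reduced characteristic polynomial, so m |-> u (p * m) is a power sum over the
   p-th powers of the b; Frobenius keeps their d-th powers distinct. *)
Lemma recurrence_zeros_mod (R : rcfType) (C q : R) (k : nat) (a u : nat -> int)
    (N : nat -> int) (p l h n0 : nat) :
  zeros_bounded C q k ->
  (0 < k)%N -> linear_recurrence k a u ->
  power_discriminants (char_poly_rec k a) k N ->
  prime p -> ~~ (p %| a k)%Z -> ~~ (p %| u n0)%Z ->
  (forall d, (0 < d <= 2 ^ l)%N -> ~~ (p %| N d)%Z) ->
  (\sum_(m < 2 ^ l) (p %| u (p * (h + m))%N)%Z)%N%:R <= C * (2 * q) ^+ l.
Proof.
move=> HC k0 ur NP pp pak pu pN.
have [K [phi _]] := countable_algebraic_closure 'F_p.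
have pK : p \in [pchar K] by apply: (rmorph_pchar phi); apply: pchar_Fp.
pose f := char_poly_rec k a; pose fK : {poly K} := map_poly intr f.
have /andP[fm /eqP fs] := char_poly_rec_monic k a.
have fKm : fK \is monic by apply: monic_map.
have fKs : size fK = k.+1.
  by rewrite -fs; apply: size_map_poly_id0; rewrite (monicP fm) /= oner_neq0.
have [r] := closed_field_poly_normal fK; rewrite (monicP fKm) scale1r => fr.
have sr : size r = k by apply/eqP; rewrite -eqSS -fKs fr size_prod_XsubC.
pose b (i : 'I_k) := r`_i.
have fb : fK = \prod_(i < k) ('X - (b i)%:P) by rewrite fr (big_nth 0) sr big_mkord.
have broot i : root fK (b i) by rewrite fr root_prod_XsubC mem_nth // sr.
have bd d i j : (0 < d <= 2 ^ l)%N -> i != j -> b i ^+ d != b j ^+ d.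
  move=> /pN; rewrite (dvdz_pcharf pK) (NP _ _ _ fb) => + ij.
  apply: contra => /eqP bij; apply/prodf_eq0; exists i => //.
  by apply/prodf_eq0; exists j; rewrite ?bij ?subrr // eq_sym.
have b0 i : b i != 0 by apply: char_poly_root_neq0 (broot i); rewrite // -(dvdz_pcharf pK).
have binj : injective b.
  move=> i j bij; apply/eqP; apply/negPn/negP => /(bd 1%N).
  by rewrite !expr1 bij eqxx expn_gt0 => /(_ isT).
have [B uB] := recurrence_power_sum ur binj broot.
have frob : injective (fun x : K => x ^+ p) by apply: (fmorph_inj (pFrobenius_aut pK)).
(* Vanishing coefficients are dropped, and the shift [h] is absorbed into the others. *)
pose s := [seq (B i * b i ^+ (p * h), b i ^+ p) | i <- enum 'I_k & B i != 0].
have sE m : power_sum s m = (u (p * (h + m))%N)%:~R.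
  rewrite uB /power_sum big_map big_filter big_enum_cond /= big_mkcond; apply: eq_bigr => i _.
  by case: eqP => [->|_]; rewrite ?mul0r // -mulrA -exprM -exprD mulnDr.
have := HC K s l _ _ _.
under eq_bigr => m _ do rewrite sE -(dvdz_pcharf pK).
apply.
- rewrite size_map; apply/andP; split; last first.
    by apply: (leq_trans (size_subseq (filter_subseq _ _))); rewrite size_enum_ord.
  (* If every coefficient vanished, p would divide all u n, including [u n0]. *)
  rewrite size_filter -has_count; apply: contraNT pu => /hasPn H.
  rewrite (dvdz_pcharf pK) uB big1 // => i _.
  by have /negPn/eqP-> := H i (mem_enum _ i); rewrite mul0r.
- rewrite all_map all_filter; apply/allP => i _ /=; apply/implyP => Bi.
  by rewrite mulf_neq0 // expf_neq0.
- move=> d dl; rewrite /s pairwise_map; apply: pairwise_filter.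
  have := enum_uniq 'I_k; rewrite uniq_pairwise; apply: sub_pairwise => i j /= ij.
  rewrite -!exprM mulnC !exprM (inj_eq frob); exact: bd.
Qed.

(** * Size of the power discriminants *)

Lemma complex_norm_bound (R : realType) (z : R[i]) : exists M : nat, `|z| <= M%:R.
Proof.
rewrite normc_def; set r := Num.sqrt _; exists (Num.bound r).
rewrite -(rmorph_nat (@real_complex R)) lecR.
by apply/ltW/archi_boundP/sqrtr_ge0.
Qed.

Lemma char_poly_rec_split (F : fieldType) (k : nat) (a : nat -> int) (b : 'I_k -> F) :
  injective b -> (forall i, root (map_poly intr (char_poly_rec k a)) (b i)) ->
  map_poly intr (char_poly_rec k a) = \prod_(i < k) ('X - (b i)%:P).
Proof.
move=> binj broot.
have /andP[fm /eqP fs] := char_poly_rec_monic k a.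
pose rs := [seq b i | i <- enum 'I_k].
have szf : size (map_poly intr (char_poly_rec k a) : {poly F}) = (size rs).+1.
  by rewrite size_map_poly_id0 ?(monicP fm) ?oner_neq0 // fs size_map size_enum_ord.
rewrite (all_roots_prod_XsubC szf).
- by rewrite (monicP (monic_map _ fm)) scale1r big_map big_enum.
- by rewrite all_map; apply/allP => i _; exact: broot.
- by rewrite uniq_rootsE map_inj_uniq ?enum_uniq.
Qed.

(** A vanishing factor would make a ratio of two roots a d-th root of unity; this is where
    nondegeneracy enters. *)
Lemma power_diff_prod_growth (R : realType) (k : nat) (a : nat -> int)
    (alpha : 'I_k -> R[i]) (N : nat -> int) :
  (0 < k)%N -> a k != 0 -> injective alpha ->
  (forall i, root (map_poly intr (char_poly_rec k a)) (alpha i)) ->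
  nondegenerate_roots alpha ->
  power_discriminants (char_poly_rec k a) k N ->
  exists h : nat, forall d, (0 < d)%N -> N d != 0 /\ (`|N d|%N <= 2 ^ (h * d))%N.
Proof.
move=> k0 ak inj rt nd NP.
have NE d := NP d _ _ (char_poly_rec_split inj rt).
have a0 i : alpha i != 0 by apply: char_poly_root_neq0 (rt i); rewrite // intr_eq0.
have [M HM] : exists M : nat, forall i, `|alpha i| <= M%:R.
  have /fin_all_exists[m Hm] i := complex_norm_bound (alpha i).
  exists (\sum_i m i)%N => i; apply: (le_trans (Hm i)).
  by rewrite ler_nat (bigD1 i) //= leq_addr.
(* Each factor is at most 2 (M + 1)^d <= M'^d, there are at most k^2 of them, and M' <= 2^M'. *)
pose M' := (2 * M.+1)%N; exists (M' * k * k)%N => d d0; split.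
  rewrite -(intr_eq0 R[i]) NE; apply/prodf_neq0 => i _; apply/prodf_neq0 => j ji.
  rewrite subr_eq0; apply: contra (nd i j _ d d0); last by rewrite eq_sym.
  by move=> /eqP e; rewrite unity_rootE expr_div_n e divff // expf_neq0.
apply: (@leq_trans (M' ^ (d * k * k))).
  rewrite -(ler_nat R[i]) natr_absz intr_norm NE normr_prod.
  rewrite natrX !exprM -[X in _ <= _ ^+ X]card_ord -prodr_const.
  apply: ler_prod => i _; rewrite normr_ge0 normr_prod.
  rewrite -[X in _ <= _ ^+ X]card_ord -prodr_const big_mkcond /=.
  apply: ler_prod => j _; have M1 : 1 <= (M'%:R : R[i]) ^+ d by rewrite exprn_ege1 // ler1n.
  case: ifP => _; rewrite ?ler01 ?M1 ?normr_ge0 //=.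
  apply: (le_trans (ler_normB _ _)).
  have H l : `|alpha l ^+ d| <= M.+1%:R ^+ d.
    rewrite normrX lerXn2r ?nnegrE ?ler0n //.
    by apply: (le_trans (HM l)); rewrite ler_nat.
  apply: (le_trans (lerD (H i) (H j))); rewrite /M' natrM exprMn -mulr2n -[leLHS]mulr_natl.
  by rewrite ler_wpM2r ?exprn_ge0 // -[leLHS]expr1 ler_weXn2l // ler1n.
rewrite (_ : M' * k * k * d = M' * (d * k * k))%N; last by lia.
by rewrite [leqRHS]expnM leq_exp2r ?muln_gt0 ?d0 ?k0 // ltnW // ltn_expl.
Qed.

(** * Prime factors and Chebyshev's estimate *)

Lemma prod_pfactor_le (M n : nat) (Q : pred nat) : (0 < n)%N ->
  (\prod_(0 <= p < M | Q p) p ^ logn p n <= n)%N.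
Proof.
move=> n0; have pos p : (0 < p ^ logn p n)%N.
  by case: p => [|p]; [rewrite lognE | rewrite expn_gt0].
apply: (@leq_trans (\prod_(0 <= p < (M + n).+1) p ^ logn p n)%N).
  rewrite [leqRHS](@big_cat_nat _ _ _ M) //=; last by lia.
  rewrite -[leqLHS]muln1; apply: leq_mul.
    rewrite big_mkcond; apply: leq_prod => p _; by case: ifP.
  by apply: prodn_gt0 => p.
have := widen_partn predT (leq_addl M n); rewrite partnT // => E.
by rewrite [leqRHS]E; apply/eq_leq/eq_bigl.
Qed.

(** With m = 2^i, the primes in (m, 2 m] divide the binomial coefficient of 2 m over m, which is at
    most 4^m; the extra [i] allows for p = m. *)
Lemma prime_count_dyadic (i : nat) :
  (i * \sum_(2 ^ i <= p < 2 ^ i.+1 | prime p) 1 <= 2 ^ i.+1 + i)%N.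
Proof.
set m := (2 ^ i)%N; have m0 : (0 < m)%N by rewrite expn_gt0.
have E : (2 ^ i.+1 = 2 * m)%N by rewrite expnS.
pose c := (\sum_(m.+1 <= p < (2 * m).+1 | prime p) 1)%N.
have cB : (i * c <= 2 * m)%N.
  have B0 : (0 < 'C(2 * m, m))%N by rewrite bin_gt0; lia.
  rewrite -(@leq_exp2l 2) //.
  apply: (@leq_trans 'C(2 * m, m)); last first.
    rewrite -[leqRHS]/((1 + 1) ^ (2 * m))%N Pascal.
    have ml : (m < (2 * m).+1)%N by lia.
    by rewrite (bigD1 (Ordinal ml)) //= !exp1n !muln1 leq_addr.
  apply: (leq_trans _ (@prod_pfactor_le (2 * m).+1 'C(2 * m, m)
    (fun p => (m < p)%N && prime p) B0)).
  rewrite /c (big_nat_widenl _ 0) // expnM -/m expn_sum big_nat_cond [leqRHS]big_nat_cond.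
  rewrite (eq_bigl (fun p => (0 <= p < (2 * m).+1) && ((m < p) && prime p))%N); last first.
    by move=> p; rewrite [prime p && _]andbC.
  apply: leq_prod => p /andP[/= p2m /andP[mp pp]].
  rewrite expn1; apply: (leq_trans (ltnW mp)).
  rewrite -[leqLHS]expn1; apply: leq_pexp2l; first exact: prime_gt0.
  rewrite logn_gt0 mem_primes pp B0 /=.
  have : (p %| (2 * m)`!)%N by rewrite dvdn_fact // prime_gt0.
  have m2m : (m <= 2 * m)%N by lia.
  rewrite -(bin_fact m2m) (_ : 2 * m - m = m)%N; last by lia.
  have ndvd n : (n < p)%N -> ~~ (p %| n`!)%N.
    elim: n => [|n IH] np; first by rewrite fact0 dvdn1 neq_ltn prime_gt1 // orbT.
    by rewrite factS Euclid_dvdM // negb_or gtnNdvd //= IH // ltnW.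
  have pm := ndvd m mp.
  by rewrite !Euclid_dvdM // (negbTE pm) !orbF.
rewrite E; have : (\sum_(m <= p < 2 * m | prime p) 1 <= 1 + c)%N.
  rewrite big_ltn_cond; last by lia.
  have H : (\sum_(m.+1 <= p < 2 * m | prime p) 1 <= c)%N.
    rewrite /c [leqRHS](@big_cat_nat _ _ _ (2 * m)) //=; last by lia.
    exact: leq_addr.
  by case: ifP => _; lia.
by move=> /(leq_mul (leqnn i)); lia.
Qed.

Lemma sum_multiples (T : nmodType) (x p : nat) (F : nat -> T) : (0 < p)%N ->
  \sum_(0 <= n < x.+1 | (p %| n)%N) F n = \sum_(0 <= m < (x %/ p).+1) F (p * m)%N.
Proof.
move=> p0; elim: x => [|x IH].
  by rewrite div0n big_mkcond !big_nat1 dvdn0 muln0.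
rewrite big_mkcond big_nat_recr //= -big_mkcond IH divnS //.
case: ifP => pd; last by rewrite addr0.
rewrite add1n [RHS]big_nat_recr //=; congr (_ + F _).
by rewrite -[LHS](divnK pd) mulnC divnS // pd add1n.
Qed.

Lemma count_multiples (x q : nat) : (0 < q)%N ->
  (\sum_(1 <= n < x.+1) (q %| n) = x %/ q)%N.
Proof.
move=> q0; elim: x => [|x IH]; first by rewrite big_geq // div0n.
by rewrite big_nat_recr //= IH divnS // addnC.
Qed.

(** By induction with [x %/ p] in place of [x], the sum is at most twice [x %/ p]. *)
Lemma sum_div_powers (p x A : nat) : (1 < p)%N ->
  (\sum_(j < A) x %/ p ^ j.+1 <= x)%N.
Proof.
move=> p1; elim: A x => [|A IH] x; first by rewrite big_ord0.
rewrite big_ord_recl /= expn1.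
under eq_bigr => j _ do rewrite /bump leq0n add1n expnS divnMA.
apply: (leq_trans (leq_add (leqnn _) (IH _))); rewrite addnn -muln2.
by apply: leq_trans (leq_trunc_div x p); rewrite leq_mul2l p1 orbT.
Qed.

Lemma sum_prime_logs (N h M : nat) (Q : pred nat) : (0 < N)%N -> (N <= 2 ^ h)%N ->
  (\sum_(0 <= p < M | prime p && (p %| N) && Q p) trunc_log 2 p <= h)%N.
Proof.
move=> N0 Nh; rewrite -(@leq_exp2l 2) //; apply: leq_trans Nh.
apply: leq_trans (@prod_pfactor_le M N (fun p => prime p && (p %| N)%N && Q p) N0).
rewrite expn_sum; apply: leq_prod => p /andP[/andP[pp pN] _].
apply: (@leq_trans p); first by rewrite trunc_logP // prime_gt0.
rewrite -[leqLHS]expn1; apply: leq_pexp2l; first exact: prime_gt0.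
by rewrite logn_gt0 mem_primes pp N0.
Qed.

(** The primes below [P] contribute at most 2^(b P) to n. For the others p < 2^(w + 1) <= 2^(2 w)
    with w = [trunc_log 2 p] >= 1, whence the factor 2. *)
Lemma log_le_weight (n x P e b : nat) : (0 < n <= x)%N -> (2 ^ e <= n)%N ->
  (forall p, (p < P)%N -> (p ^ logn p n <= 2 ^ b)%N) ->
  (e <= b * P + 2 * \sum_(P <= p < x.+1 | prime p) logn p n * trunc_log 2 p)%N.
Proof.
move=> /andP[n0 nx] en small; rewrite -(@leq_exp2l 2) //; apply: (leq_trans en).
have := widen_partn predT nx; rewrite partnT // => E.
rewrite [leqLHS]E {E} [leqLHS](eq_bigl xpredT) // expnD.
have pos p : (0 < p ^ logn p n)%N.
  by case: p => [|p]; [rewrite lognE | rewrite expn_gt0].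
have big p : (p ^ logn p n <= if prime p then 2 ^ (2 * (logn p n * trunc_log 2 p)) else 1)%N.
  case: ifP => [pp|np]; last by rewrite lognE np.
  rewrite [X in (2 ^ X)%N](_ : _ = (2 * trunc_log 2 p) * logn p n)%N; last by lia.
  have [->|lp] := posnP (logn p n); first by rewrite muln0.
  rewrite expnM leq_exp2r // (leq_trans (ltnW (trunc_log_ltn p (isT : 1 < 2)%N))) //.
  rewrite leq_exp2l //; have : (0 < trunc_log 2 p)%N by rewrite trunc_log_gt0 /= prime_gt1.
  by lia.
have [Px|xP] := leqP P x.+1.
  rewrite (@big_cat_nat _ _ _ P) //=; apply: leq_mul.
    rewrite expnM -[X in (_ <= _ ^ X)%N]subn0 -prod_nat_const_nat big_nat [leqRHS]big_nat.
    by apply: leq_prod => p; exact: small.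
  rewrite big_distrr /= expn_sum [leqRHS]big_mkcond.
  apply: leq_prod => p _. exact: big.
rewrite (big_geq (ltnW xP)) muln0 muln1 expnM.
apply: (@leq_trans ((2 ^ b) ^ x.+1)%N); last by rewrite leq_pexp2l ?expn_gt0 // ltnW.
rewrite -[X in (_ <= _ ^ X)%N]subn0 -prod_nat_const_nat big_nat [leqRHS]big_nat.
by apply: leq_prod => p /andP[_ px]; apply: small; lia.
Qed.

(* The first power of p contributes the m with n = p m, for which p divides u (p m);
   the higher powers contribute a convergent sum over p. *)
Lemma sum_logn_le (p x : nat) (S Z : pred nat) : prime p ->
  (forall n, S n -> (0 < n)%N) -> (forall m, S (p * m)%N -> Z m) ->
  (\sum_(0 <= n < x.+1 | S n) logn p n <=
   \sum_(0 <= m < (x %/ p).+1) Z m + 2 * (x %/ p ^ 2))%N.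
Proof.
move=> pp S0 SZ; have p1 := prime_gt1 pp.
have lE n : (0 < n < x.+1)%N ->
    (logn p n <= (p %| n) + \sum_(j < x.+1) (p ^ j.+2 %| n))%N.
  move=> /andP[n0 nx]; rewrite (logn_count_dvd _ pp).
  apply: (@leq_trans (\sum_(1 <= k < x.+3) (p ^ k %| n))%N).
    rewrite [leqRHS](@big_cat_nat _ _ _ n) //=; last by lia.
    exact: leq_addr.
  by rewrite big_nat_recl // expn1 big_add1 /= big_mkord.
apply: (@leq_trans (\sum_(0 <= n < x.+1 | S n) (p %| n) +
    \sum_(0 <= n < x.+1 | S n) \sum_(j < x.+1) (p ^ j.+2 %| n))%N).
  rewrite -big_split /= big_nat_cond [leqRHS]big_nat_cond.
  by apply: leq_sum => n /andP[/andP[_ nx] Sn]; apply: lE; rewrite S0.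
apply: leq_add.
  have := sum_multiples x (fun n => S n : nat) (prime_gt0 pp).
  rewrite (_ : (\sum_(0 <= n < x.+1 | S n) (p %| n) =
               \sum_(0 <= n < x.+1 | p %| n) S n)%N); last first.
    by rewrite big_mkcond [RHS]big_mkcond; apply: eq_bigr => n _; case: (S n); case: (p %| n)%N.
  move=> ->; apply: leq_sum => m _; have := SZ m; case: (S _) => // /(_ isT) ->.
  by [].
rewrite exchange_big /=.
apply: (@leq_trans (\sum_(j < x.+1) x %/ p ^ j.+2)%N).
  apply: leq_sum => j _; rewrite -count_multiples ?expn_gt0 ?prime_gt0 //.
  rewrite big_mkcond big_ltn //= ifN; last by apply/negP => /S0.
  by rewrite add0n; apply: leq_sum => n _; case: (S n).
(* The term j = 0 is [x %/ p ^ 2]; the higher powers together add at most as much again. *)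
rewrite big_ord_recl mul2n -addnn leq_add2l.
under eq_bigr => j _ do rewrite /= /bump leq0n add1n -[j.+3]/(2 + j.+1)%N expnD divnMA.
exact: sum_div_powers.
Qed.

(** Such n are multiples of the least power of p that is at least 2^b. *)
Lemma count_large_part (p x b : nat) :
  (\sum_(1 <= n < x.+1) (2 ^ b < p ^ logn p n) <= x %/ 2 ^ b)%N.
Proof.
have [pp|np] := boolP (prime p); last first.
  rewrite big1 // => n _; rewrite lognE (negbTE np) /= expn0.
  by rewrite ltnNge expn_gt0.
have p1 := prime_gt1 pp; set v := up_log p (2 ^ b).
have pv : (2 ^ b <= p ^ v)%N by apply: up_logP.
apply: (@leq_trans (x %/ p ^ v)%N); last by rewrite leq_div2l // expn_gt0.
rewrite -count_multiples; last by rewrite expn_gt0 prime_gt0.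
rewrite big_nat [leqRHS]big_nat; apply: leq_sum => n /andP[n0 _].
case: ltnP => // /ltnW H.
by rewrite pfactor_dvdn // up_log_min.
Qed.

(* Both kinds of exceptional n are rare: those below 2^e, and those divisible by a
   large power of a prime below P. Any other n is essentially a product of primes
   at least P, so the weights dominate X. *)
Lemma weighted_count (x X P e b : nat) (S : pred nat) :
  (forall n, S n -> (0 < n)%N) -> (X + 4 * (b * P) <= 4 * e)%N ->
  (X * \sum_(0 <= n < x.+1 | S n) 1 <=
   X * 2 ^ e + X * (P * (x %/ 2 ^ b)) +
   8 * \sum_(P <= p < x.+1 | prime p)
         trunc_log 2 p * \sum_(0 <= n < x.+1 | S n) logn p n)%N.
Proof.
move=> S0 HX; pose f n := (\sum_(p < P) (2 ^ b < p ^ logn p n))%N.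
pose w n := (\sum_(P <= p < x.+1 | prime p) logn p n * trunc_log 2 p)%N.
(* For ordinary n, e <= b P + 2 w and X + 4 b P <= 4 e give X <= 8 w. *)
have H n : (0 < n < x.+1)%N -> (X <= X * (n < 2 ^ e) + X * f n + 8 * w n)%N.
  move=> nx; case: (ltnP n (2 ^ e)) => ne; first by lia.
  have [f0|f0] := posnP (f n); last by case: (f n) f0 => // m _; lia.
  have small p : (p < P)%N -> (p ^ logn p n <= 2 ^ b)%N.
    move=> pP; rewrite leqNgt; apply/negP => H.
    by move: f0; rewrite /f (bigD1 (Ordinal pP)) //= H.
  by have := log_le_weight nx ne small; rewrite -/(w n); lia.
apply: (@leq_trans (\sum_(0 <= n < x.+1 | S n) (X * (n < 2 ^ e) + X * f n + 8 * w n))%N).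
  rewrite big_distrr /= big_nat_cond [leqRHS]big_nat_cond; apply: leq_sum => n.
  by move=> /andP[/andP[_ nx] Sn]; rewrite muln1 H // S0.
rewrite big_split big_split /= -!big_distrr /=; apply: leq_add; first apply: leq_add.
- rewrite leq_mul2l; apply/orP; right.
  have cnt N : (\sum_(0 <= n < N) (n < 2 ^ e) = minn N (2 ^ e))%N.
    elim: N => [|N IH]; first by rewrite big_geq // min0n.
    by rewrite big_nat_recr //= IH; case: ltnP; lia.
  apply: leq_trans (geq_minr x.+1 (2 ^ e)); rewrite -cnt big_mkcond.
  by apply: leq_sum => n _; case: (S n).
- rewrite leq_mul2l; apply/orP; right; rewrite exchange_big /=.
  rewrite -[P in leqRHS]card_ord -sum_nat_const; apply: leq_sum => p _.
  apply: leq_trans (count_large_part p x b).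
  rewrite big_mkcond big_ltn //= ifN; last by apply/negP => /S0.
  by rewrite add0n; apply: leq_sum => n _; case: (S n).
- rewrite leq_mul2l /= /w exchange_big /=; apply: leq_sum => p _.
  by rewrite big_distrr /=; apply: leq_sum => n _; rewrite mulnC.
Qed.

(** * Dyadic and geometric sums *)

Lemma sum_dyadic (T : nmodType) (n : nat) (Q : pred nat) (F : nat -> T) :
  \sum_(1 <= p < 2 ^ n | Q p) F p = \sum_(i < n) \sum_(2 ^ i <= p < 2 ^ i.+1 | Q p) F p.
Proof.
elim: n => [|n IH]; first by rewrite big_ord0 big_geq.
rewrite big_ord_recr /= -IH (@big_cat_nat _ _ _ (2 ^ n)) //= ?expn_gt0 //.
by rewrite leq_exp2l.
Qed.

Lemma geometric_sum_le (R : realFieldType) (q : R) (n : nat) : 0 <= q -> q < 1 ->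
  \sum_(i < n) q ^+ i <= (1 - q)^-1.
Proof.
move=> q0 q1; rewrite -[leRHS]mulr1 mulrC ler_pdivlMr; last by lra.
rewrite mulrC -[X in X * _]opprB mulNr -subrX1 opprB.
by have := exprn_ge0 n q0; lra.
Qed.

Lemma geometric_sum4_le (R : realFieldType) (q : R) (n : nat) : 0 <= q -> q < 1 ->
  \sum_(i < n) q ^+ (i %/ 4) <= 4 * (1 - q)^-1.
Proof.
move=> q0 q1; apply: (@le_trans _ _ (\sum_(i < n * 4) q ^+ (i %/ 4))).
  rewrite -!(big_mkord xpredT (fun i => q ^+ (i %/ 4)%N)).
  rewrite [leRHS](@big_cat_nat _ _ _ n) //=; last by lia.
  by rewrite lerDl sumr_ge0 // => i _; rewrite exprn_ge0.
rewrite -(big_mkord xpredT (fun i => q ^+ (i %/ 4)%N)) big_nat_mul.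
apply: (@le_trans _ _ (\sum_(0 <= i < n) 4 * q ^+ i)).
  apply: ler_sum => i _; rewrite (eq_big_nat _ _ (F2 := fun _ => q ^+ i)).
    by rewrite sumr_const_nat -mulnBl subSnn mulr_natl.
  by move=> j ij; congr (_ ^+ _); lia.
by rewrite -mulr_sumr big_mkord ler_wpM2l // geometric_sum_le.
Qed.

(** At i = n the truncated exponent is 0, which costs the extra 1. *)
Lemma rev_geometric_sum_le (R : realFieldType) (q : R) (n : nat) : 0 <= q -> q < 1 ->
  \sum_(i < n.+1) q ^+ (n - i.+1) <= 1 + (1 - q)^-1.
Proof.
move=> q0 q1; rewrite big_ord_recr /= subnS subnn expr0 addrC lerD2l.
rewrite (reindex_inj rev_ord_inj) /=.
rewrite (eq_bigr (fun i : 'I_n => q ^+ i)); first exact: geometric_sum_le.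
by move=> i _; congr (_ ^+ _); have := ltn_ord i; lia.
Qed.

(** * Sparsity of the exceptional primes *)

(** With y = n + 1, the right side grows by 2 / (y (y + 1)) >= 1 / y^2. *)
Lemma inv_sqr_sum_le (R : realFieldType) (n : nat) :
  \sum_(0 <= d < n) (d.+1%:R ^+ 2)^-1 <= 2 - 2 * n.+1%:R^-1 :> R.
Proof.
elim: n => [|n IH]; first by rewrite big_geq // invr1; lra.
rewrite big_nat_recr //=; apply: (le_trans (lerD IH (lexx _))).
have n1 : 1 <= n.+1%:R :> R by rewrite ler1n.
have -> : n.+2%:R = n.+1%:R + 1 :> R by rewrite -natr1.
set y : R := n.+1%:R in n1 *.
rewrite -subr_ge0 (_ : _ - _ = (y - 1) / (y ^+ 2 * (y + 1))); last by field; lra.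
by apply: divr_ge0; nra.
Qed.

(* For a good p of size 2^w the roots modulo p have distinct d-th powers for all
   d <= 2^(w/4). *)
Definition good_prime (N : nat -> int) (p : nat) : bool :=
  all (fun d => (d ^ 4 <= p)%N ==> ~~ (p %| `|N d|)%N) (iota 1 p).

(* For each d, the bad p with p %| N d have sum of logarithms O(d) and are at least
   max(d^4, D^4) >= d^3 D; the sum over d converges and is small for D large. *)
Lemma bad_prime_sum (R : realFieldType) (N : nat -> int) (h D P x : nat) :
  (0 < D)%N -> (2 * h <= D)%N -> (D ^ 4 <= P)%N ->
  (forall d, (0 < d)%N -> N d != 0 /\ (`|N d|%N <= 2 ^ (h * d))%N) ->
  \sum_(P <= p < x.+1 | prime p && ~~ good_prime N p)
     (trunc_log 2 p)%:R / p%:R <= 1 :> R.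
Proof.
move=> D0 hD DP NB.
pose t p : R := (trunc_log 2 p)%:R / p%:R.
have t0 p : 0 <= t p by rewrite divr_ge0.
pose Q d p := (d ^ 4 <= p)%N && (p %| `|N d|)%N.
apply: (@le_trans _ _ (\sum_(P <= p < x.+1 | prime p) \sum_(1 <= d < x.+1 | Q d p) t p)).
  rewrite [leRHS](bigID (good_prime N)) /= -[leLHS]add0r; apply: lerD.
    by apply: sumr_ge0 => p _; apply: sumr_ge0.
  rewrite big_nat_cond [leRHS]big_nat_cond; apply: ler_sum => p /andP[/andP[_ px] /andP[_]].
  rewrite /good_prime -has_predC => /hasP[d]; rewrite mem_iota => /andP[d1 dp].
  rewrite /= negb_imply negbK -/(Q d p) => Qd.
  rewrite (big_cat_nat d1) /=; last by lia.
  rewrite [X in _ + X]big_ltn_cond; last by lia.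
  by rewrite Qd addrCA lerDl addr_ge0 // sumr_ge0.
rewrite (exchange_big_dep_nat xpredT) //=.
(* For fixed d the logarithms sum to at most h d; dividing by d^3 D with 2 h <= D leaves 1 / (2
   d^2). *)
apply: (@le_trans _ _ (\sum_(1 <= d < x.+1) 2^-1 * (d%:R ^+ 2)^-1)); last first.
  rewrite -mulr_sumr big_add1 /=; have := inv_sqr_sum_le R x.
  have : 0 <= x.+1%:R^-1 :> R by rewrite invr_ge0.
  move: (x.+1%:R^-1) (\sum_(_ <= _ < _) _) => y S; lra.
rewrite big_nat_cond [leRHS]big_nat_cond; apply: ler_sum => d /andP[/andP[d1 _] _].
have [Nd0 NdB] := NB d d1.
have dD0 : 0 < (d ^ 3 * D)%N%:R :> R by rewrite ltr0n muln_gt0 expn_gt0 d1.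
apply: (@le_trans _ _ (\sum_(P <= p < x.+1 | prime p && Q d p)
    (trunc_log 2 p)%:R / (d ^ 3 * D)%N%:R)).
  rewrite big_nat_cond [leRHS]big_nat_cond; apply: ler_sum => p.
  move=> /andP[/andP[Pp _] /andP[pp /andP[dp _]]].
  have p0 : 0 < p%:R :> R by rewrite ltr0n prime_gt0.
  apply: ler_wpM2l => //; rewrite lef_pV2 ?posrE // ler_nat.
  have [Dd|dD] := leqP D d.
    by apply: leq_trans dp; rewrite [leqRHS]expnSr leq_mul2l Dd orbT.
  apply: leq_trans Pp; apply: leq_trans DP; rewrite [leqRHS]expnSr leq_mul2r.
  by rewrite leq_exp2r // ltnW ?orbT.
rewrite -mulr_suml -natr_sum.
have : (\sum_(P <= p < x.+1 | prime p && Q d p) trunc_log 2 p <= h * d)%N.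
  apply: leq_trans (@sum_prime_logs `|N d|%N (h * d) x.+1
    (fun p => (d ^ 4 <= p) && (P <= p))%N _ NdB).
    rewrite (big_nat_widenl _ 0) //; apply/eq_leq/eq_bigl => p.
    by rewrite /Q; case: (prime p) => //=; case: (_ %| _)%N; rewrite ?andbF // !andbT.
  by rewrite absz_gt0.
rewrite -(ler_nat R) => H; rewrite ler_pdivrMr //; apply: (le_trans H).
have d0 : 0 < d%:R :> R by rewrite ltr0n.
rewrite (natrM R h) (natrM R (d ^ 3)) natrX.
have -> : 2^-1 * (d%:R ^+ 2)^-1 * (d%:R ^+ 3 * D%:R) = 2^-1 * D%:R * d%:R :> R by field; lra.
apply: ler_wpM2r; first exact: ltW.
by move: hD; rewrite -(ler_nat R) natrM; lra.
Qed.

(** * Weighted sum over the primes *)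

(** A dyadic block of primes has total weight O(1) for log p / p, so the savings at good primes sum
    geometrically over the blocks. Bad primes use the trivial bound and contribute at most 2 x. *)
Lemma weighted_sum_bound (R : realFieldType) (C q : R) (x X P : nat)
    (c : nat -> nat) (good : pred nat) :
  0 < C -> 0 <= q -> q < 1 -> (2 ^ X <= x < 2 ^ X.+1)%N -> (0 < P)%N ->
  (forall p, prime p -> (P <= p <= x)%N -> good p ->
     (c p)%:R <= 2 * C * (x%:R / p%:R) *
       (q ^+ (trunc_log 2 p %/ 4) + q ^+ (X - (trunc_log 2 p).+1))) ->
  (forall p, (0 < p <= x)%N -> (c p)%:R <= 2 * (x%:R / p%:R) :> R) ->
  \sum_(P <= p < x.+1 | prime p && ~~ good p) (trunc_log 2 p)%:R / p%:R <= 1 :> R ->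
  (\sum_(P <= p < x.+1 | prime p)
     trunc_log 2 p * (c p + 2 * (x %/ p ^ 2)))%N%:R <=
  (3 * (2 * C * (5 * (1 - q)^-1 + 1) + 4) + 2) * x%:R.
Proof.
move=> C0 q0 q1 /andP[Xx xX] P0 Hg Hc Hbad.
pose w p := trunc_log 2 p.
(* For good p with [trunc_log 2 p = i], x 2^(-i) G i bounds the count plus 2 x / p^2; the last
   summand handles the square. *)
pose G (i : nat) : R := 2 * C * (q ^+ (i %/ 4) + q ^+ (X - i.+1)) + 2 * 2^-1 ^+ i.
have G0 i : 0 <= G i.
  by rewrite addr_ge0 // mulr_ge0 ?exprn_ge0 ?addr_ge0 ?exprn_ge0 // ?invr_ge0 // mulr_ge0 // ltW.
have x0 : 0 < x%:R :> R by rewrite ltr0n; apply: leq_trans Xx; rewrite expn_gt0.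
have inv2X i : (2 ^- i = 2^-1 ^+ i :> R) by rewrite exprVn.
have pB p : prime p -> (P <= p <= x)%N ->
    (w p * (c p + 2 * (x %/ p ^ 2)))%N%:R <=
    (if good p then 0 else 2 * x%:R * ((w p)%:R / p%:R)) +
    x%:R * ((w p)%:R * (2^-1 ^+ w p * G (w p))).
  move=> pp /andP[Pp px]; have p0 : 0 < p%:R :> R by rewrite ltr0n prime_gt0.
  have pw : p%:R^-1 <= 2^-1 ^+ w p :> R.
    rewrite -inv2X lef_pV2 ?posrE ?exprn_gt0 // -natrX ler_nat.
    by rewrite trunc_logP // prime_gt0.
  have sq : (x %/ p ^ 2)%N%:R <= x%:R * (2^-1 ^+ w p * 2^-1 ^+ w p) :> R.
    apply: (@le_trans _ _ (x%:R / (p ^ 2)%N%:R)).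
      by rewrite ler_pdivlMr ?natrX ?exprn_gt0 // -natrX -natrM ler_nat leq_trunc_div.
    rewrite natrX expr2 invfM; apply: ler_wpM2l; first exact: ltW.
    by apply: ler_pM => //; rewrite invr_ge0 ltW.
  rewrite natrM natrD natrM.
  set W : R := (w p)%:R; have W0 : 0 <= W by rewrite /W.
  set y := 2^-1 ^+ w p in pw sq *.
  have y0 : 0 <= y by rewrite exprn_ge0 // invr_ge0.
  case: ifP => gp.
    rewrite add0r [leRHS]mulrCA; apply: ler_wpM2l => //; rewrite /G -/y.
    have := Hg p pp; rewrite Pp px gp => /(_ isT isT); rewrite -/(w p).
    set g := _ + q ^+ _ => Hgp.
    have g0 : 0 <= g by rewrite addr_ge0 // exprn_ge0.
    apply: (@le_trans _ _ (2 * C * (x%:R * y) * g + 2 * (x%:R * (y * y)))).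
      2: by rewrite le_eqVlt; apply/orP; left; apply/eqP; ring.
    apply: lerD; last by rewrite ler_wpM2l.
    apply: (le_trans Hgp); rewrite ler_wpM2r // ler_wpM2l //; first by lra.
    by rewrite ler_wpM2l // ltW.
  have := Hc p; rewrite prime_gt0 // px => /(_ isT) Hcp.
  have -> : 2 * x%:R * (W / p%:R) + x%:R * (W * (y * G (w p))) =
     W * (2 * (x%:R / p%:R) + x%:R * (y * G (w p))) by ring.
  apply: ler_wpM2l => //; apply: lerD => //.
  apply: (@le_trans _ _ (2 * (x%:R * (y * y)))); first by rewrite ler_wpM2l.
  rewrite mulrCA; apply: ler_wpM2l; first exact: ltW.
  rewrite mulrCA; apply: ler_wpM2l => //; rewrite /G -/y lerDr.
  by rewrite mulr_ge0 ?addr_ge0 ?exprn_ge0 // mulr_ge0 // ltW.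
rewrite natr_sum.
apply: (@le_trans _ _ (\sum_(P <= p < x.+1 | prime p)
    ((if good p then 0 else 2 * x%:R * ((w p)%:R / p%:R)) +
    x%:R * ((w p)%:R * (2^-1 ^+ w p * G (w p)))))).
  rewrite big_nat_cond [leRHS]big_nat_cond; apply: ler_sum => p /andP[/andP[Pp px] pp].
  by apply: pB => //; rewrite Pp.
rewrite big_split /= [leRHS]mulrDl addrC; apply: lerD; last first.
  have -> : \sum_(P <= p < x.+1 | prime p) (if good p then 0 else 2 * x%:R * ((w p)%:R / p%:R)) =
     2 * x%:R * \sum_(P <= p < x.+1 | prime p && ~~ good p) ((w p)%:R / p%:R) :> R.
    by rewrite mulr_sumr big_mkcondr /=; apply: eq_bigr => p _; case: (good p).
  by rewrite -[leRHS]mulr1; apply: ler_wpM2l => //; lra.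
rewrite -mulr_sumr mulrC; apply: ler_wpM2r; first exact: ltW.
pose F p : R := (w p)%:R * (2^-1 ^+ w p * G (w p)).
have F0 p : 0 <= F p by rewrite mulr_ge0 // mulr_ge0 // exprn_ge0 // invr_ge0.
apply: (@le_trans _ _ (\sum_(1 <= p < 2 ^ X.+1 | prime p) F p)).
  have [Px|xP] := leqP P x.+1; last by rewrite big_geq ?sumr_ge0 // ltnW.
  rewrite (big_cat_nat P0) /=; last by lia.
  rewrite [X in _ <= _ + X](big_cat_nat Px xX) /= addrCA lerDl addr_ge0 // sumr_ge0 //.
rewrite sum_dyadic.
(* The 3 comes from 2^(i + 1) + i <= 3 * 2^i in Chebyshev's bound. *)
apply: (@le_trans _ _ (\sum_(i < X.+1) 3 * G i)).
  apply: ler_sum => i _.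
  have -> : \sum_(2 ^ i <= p < 2 ^ i.+1 | prime p) F p =
     (i * \sum_(2 ^ i <= p < 2 ^ i.+1 | prime p) 1)%N%:R * (2^-1 ^+ i * G i).
    rewrite natrM natr_sum mulr_sumr mulr_suml big_nat_cond [RHS]big_nat_cond.
    apply: eq_bigr => p /andP[/andP[ip pi] _]; rewrite mulr1 /F.
    by have -> : w p = i by apply: trunc_log_eq => //; rewrite ip.
  rewrite mulrA; apply: ler_wpM2r => //.
  have : (i * \sum_(2 ^ i <= p < 2 ^ i.+1 | prime p) 1 <= 3 * 2 ^ i)%N.
    by apply: leq_trans (prime_count_dyadic i) _; rewrite expnS;
       have := ltn_expl i (isT : 1 < 2)%N; lia.
  rewrite -(ler_nat R) (natrM R 3) natrX => /(ler_wpM2r (exprn_ge0 i (_ : 0 <= 2^-1 :> R))) H.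
  apply: (le_trans (H _)); first by rewrite invr_ge0.
  by rewrite -mulrA -exprMn divff ?expr1n ?mulr1 // pnatr_eq0.
rewrite -mulr_sumr; apply: ler_wpM2l => //.
rewrite /G big_split /= -!mulr_sumr big_split /=.
have A1 := geometric_sum4_le X.+1 q0 q1.
have A2 := rev_geometric_sum_le X q0 q1.
have h0 : 0 <= 2^-1 :> R by lra.
have h1 : 2^-1 < 1 :> R by lra.
have A3 := geometric_sum_le X.+1 h0 h1.
rewrite (_ : (1 - 2^-1)^-1 = 2) in A3; last by field.
apply: lerD; last by lra.
by apply: ler_wpM2l; lra.
Qed.

Lemma sum_blocks_le (R : realFieldType) (Z : pred nat) (L b : nat) (c : R) :
  (forall h, (\sum_(m < L) Z (h + m))%N%:R <= c) ->
  (\sum_(0 <= m < b * L) Z m)%N%:R <= b%:R * c.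
Proof.
move=> Zc; rewrite big_nat_mul natr_sum -[b in b%:R]subn0 mulr_natl -sumr_const_nat.
apply: ler_sum => i _; apply: le_trans (Zc (i * L)%N); rewrite ler_nat.
rewrite -{1}(add0n (i * L)%N) big_addn mulSn addnK big_mkord.
by apply: leq_sum => m _; rewrite addnC.
Qed.

(** The range is cut into blocks of length 2^l with l the minimum of w / 4 and X - w - 1: the first
    keeps the roots distinct, the second keeps a block no longer than x / p. The saving q^l is
    bounded by the sum of both candidates. *)
Lemma count_zeros_le (R : realFieldType) (C q : R) (Z : pred nat) (x X p : nat) :
  0 < C -> 2^-1 <= q -> q < 1 -> prime p -> (p <= x)%N -> (2 ^ X <= x)%N ->
  (forall l h, (4 * l <= trunc_log 2 p)%N ->
     (\sum_(m < 2 ^ l) Z (h + m))%N%:R <= C * (2 * q) ^+ l) ->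
  (\sum_(0 <= m < (x %/ p).+1) Z m)%N%:R <=
  2 * C * (x%:R / p%:R) *
    (q ^+ (trunc_log 2 p %/ 4) + q ^+ (X - (trunc_log 2 p).+1)).
Proof.
move=> C0 q2 q1 pp px Xx HZ; have p0 := prime_gt0 pp.
set w := trunc_log 2 p in HZ *; pose l := minn (w %/ 4) (X - w.+1).
have pw : (p < 2 ^ w.+1)%N by apply: trunc_log_ltn.
pose M := (x %/ p)%N.
have lM : (2 ^ l <= M)%N.
  rewrite leq_divRL //; apply: (@leq_trans (2 ^ (X - w.+1) * p)%N).
    by rewrite leq_mul2r leq_pexp2l ?orbT // geq_minr.
  have [wX|Xw] := leqP w.+1 X; last by rewrite (eqP (ltnW Xw : _ == _)) mul1n.
  by apply: leq_trans Xx; rewrite -[X in leqRHS](subnK wX) expnD leq_mul2l ltnW ?orbT.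
(* These blocks cover 0, ..., M and have total length at most M + 2^l <= 2 M. *)
pose b := (M %/ 2 ^ l).+1.
have q0 : 0 < q by lra.
apply: (@le_trans _ _ (b%:R * (C * (2 * q) ^+ l))).
  have lw : (4 * l <= w)%N by have := geq_minl (w %/ 4) (X - w.+1); rewrite -/l; lia.
  apply: le_trans (sum_blocks_le b (fun h => HZ l h lw)).
  rewrite ler_nat [leqRHS](@big_cat_nat _ _ _ M.+1) ?leq_addr //.
  by apply: ltn_ceil; rewrite expn_gt0.
have bM : b%:R * 2 ^+ l <= 2 * M%:R :> R.
  rewrite -natrX -!natrM ler_nat /b mulSn mul2n -addnn.
  by apply: leq_add => //; apply: leq_trunc_div.
have Mx : M%:R <= x%:R / p%:R :> R.
  by rewrite ler_pdivlMr ?ltr0n // -natrM ler_nat leq_trunc_div.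
have ql : q ^+ l <= q ^+ (w %/ 4) + q ^+ (X - w.+1).
  rewrite /l /minn; case: ifP => _; rewrite ?lerDl ?lerDr exprn_ge0 // ltW //.
set g := _ + _ in ql *.
rewrite exprMn (_ : _ * _ = b%:R * 2 ^+ l * (C * q ^+ l)); last by ring.
apply: (@le_trans _ _ (2 * (x%:R / p%:R) * (C * g))).
  2: by rewrite le_eqVlt; apply/orP; left; apply/eqP; ring.
apply: ler_pM => //.
- by rewrite mulr_ge0 // exprn_ge0.
- by rewrite mulr_ge0 ?exprn_ge0 // ltW.
- by apply: (le_trans bM); rewrite ler_pM2l.
- by rewrite ler_pM2l.
Qed.

(** Here d^4 <= 2^(4 l) <= p. *)
Lemma good_primeP (N : nat -> int) (p l d : nat) : prime p -> good_prime N p ->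
  (4 * l <= trunc_log 2 p)%N -> (0 < d <= 2 ^ l)%N -> ~~ (p %| N d)%Z.
Proof.
move=> pp /allP gp lw /andP[d0 dl].
have dp : (d ^ 4 <= p)%N.
  apply: leq_trans (trunc_logP (isT : 1 < 2)%N (prime_gt0 pp)).
  apply: (@leq_trans ((2 ^ l) ^ 4)); first by rewrite leq_exp2r.
  by rewrite -expnM mulnC leq_exp2l.
have := gp d; rewrite mem_iota d0 dp dvdzE; apply.
by rewrite add1n ltnS; apply: leq_trans dp; rewrite -[leqLHS]expn1 leq_pexp2l.
Qed.

(** * Choice of parameters and conclusion *)

(** Ensures that n with a large power of a prime below [P] are rare enough for the weight X. *)
Lemma linear_le_exp_div (P : nat) : (0 < P)%N ->
  exists X0, forall X, (X0 <= X)%N -> (P * X <= 2 ^ (X %/ (8 * P)))%N.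
Proof.
move=> P0; have PQ : (P <= 8 * P)%N by rewrite leq_pmull.
have Q0 : (0 < 8 * P)%N by rewrite muln_gt0.
move: (8 * P)%N PQ Q0 => Q PQ Q0.
exists (Q * (4 * Q + 2))%N => X XX; set m := (X %/ Q)%N.
have mQ : (4 * Q + 2 <= m)%N by rewrite leq_divRL // mulnC.
have Xm : (X <= Q * m.+1)%N by rewrite mulnC; apply/ltnW/ltn_ceil.
apply: (@leq_trans ((Q * Q) * m.+1)%N).
  by rewrite -mulnA; apply: leq_mul.
(* The first two powers of 2 dominate Q each; the third dominates m + 1 because m >= 4 Q + 2. *)
have -> : m = (Q + Q + (m - 2 * Q))%N by lia.
rewrite !expnD; apply: leq_mul; first by apply: leq_mul; apply/ltnW/ltn_expl.
have -> : (m - 2 * Q = (m - 2 * Q).-1.+1)%N by lia.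
by rewrite [leqRHS]expnS; have := ltn_expl (m - 2 * Q).-1 (isT : 1 < 2)%N; lia.
Qed.

(** Otherwise an invertible Vandermonde matrix would annihilate the coefficients. *)
Lemma power_sum_neq0 (F : fieldType) (k : nat) (b B : 'I_k -> F) (i : 'I_k) :
  injective b -> B i != 0 -> exists n : 'I_k, \sum_j B j * b j ^+ n != 0.
Proof.
move=> binj Bi; apply/existsP; apply: contraNT Bi => /existsPn H.
pose V := Vandermonde k (\row_j b j).
have Vu : V \in unitmx := Vandermonde_unitmx binj.
have V0 : V *m (\col_j B j) = 0.
  apply/matrixP => n z; rewrite !mxE; have /negPn/eqP {2}<- := H n.
  by apply: eq_bigr => j _; rewrite !mxE mulrC.
have : invmx V *m (V *m (\col_j B j)) = 0 by rewrite V0 mulmx0.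
by rewrite mulKmx // => /matrixP/(_ i 0); rewrite !mxE => ->.
Qed.

(** The sequence affects only the threshold [X0]; the constant depends on [C] and [q] alone. *)
Lemma recurrence_count_le (R : realType) (C q : R) (k : nat) (a u N : nat -> int)
    (h n0 : nat) :
  0 < C -> 2^-1 <= q -> q < 1 ->
  zeros_bounded C q k ->
  (0 < k)%N -> linear_recurrence k a u -> a k != 0 -> u n0 != 0 ->
  power_discriminants (char_poly_rec k a) k N ->
  (forall d, (0 < d)%N -> N d != 0 /\ (`|N d|%N <= 2 ^ (h * d))%N) ->
  exists X0, forall x X, (X0 <= X)%N -> (2 ^ X <= x < 2 ^ X.+1)%N ->
    (X * \sum_(0 <= n < x.+1 | self_divisors u n) 1)%N%:R <=
    (2 + 8 * (3 * (2 * C * (5 * (1 - q)^-1 + 1) + 4) + 2)) * x%:R.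
Proof.
move=> C0 q2 q1 HC k0 ur ak un NP NB.
(* [D] exceeds both absolute values, so no prime from [P] on divides [a k] or [u n0]. *)
pose D := (2 * h + `|a k| + `|u n0| + 1)%N; pose P := (D ^ 4)%N.
have D0 : (0 < D)%N by rewrite /D addn1.
have P0 : (0 < P)%N by rewrite expn_gt0 D0.
have DP : (D <= P)%N by rewrite -[leqLHS]expn1 leq_pexp2l.
have [X1 HX1] := linear_le_exp_div P0.
exists (X1 + 2)%N => x X XX /andP[Xx xX].
pose e := (X %/ 2)%N; pose b := (X %/ (8 * P))%N.
have S0 n : self_divisors u n -> (0 < n)%N by case/andP.
have eb : (X + 4 * (b * P) <= 4 * e)%N.
  have : (b * (8 * P) <= X)%N by apply: leq_trunc_div.
  by rewrite /e; move: XX; lia.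
have := weighted_count x S0 eb.
pose Z p m := (p %| u (p * m)%N)%Z.
pose c p := (\sum_(0 <= m < (x %/ p).+1) Z p m)%N.
have T : (\sum_(P <= p < x.+1 | prime p)
      trunc_log 2 p * \sum_(0 <= n < x.+1 | self_divisors u n) logn p n <=
    \sum_(P <= p < x.+1 | prime p) trunc_log 2 p * (c p + 2 * (x %/ p ^ 2)))%N.
  apply: leq_sum => p pp; rewrite leq_mul2l; apply/orP; right.
  apply: sum_logn_le => // m /andP[_]; apply: dvdz_trans.
  by rewrite dvdzE /= dvdn_mulr.
move=> /leq_trans/(_ (leq_add (leqnn _) (leq_mul (leqnn 8) T))) {T}.
(* The two exceptional kinds of n cost at most x each, the summand 2 of the constant. *)
have E1 : (X * 2 ^ e <= x)%N.
  apply: leq_trans Xx.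
  have -> : (2 ^ X = 2 ^ (X - e) * 2 ^ e)%N by rewrite -expnD subnK // leq_div.
  rewrite leq_mul2r.
  apply/orP; right; have X2 : (X <= 2 * (X - e))%N by rewrite /e; lia.
  apply: (leq_trans X2); have -> : (X - e = (X - e).-1.+1)%N by rewrite /e; lia.
  by rewrite expnS leq_mul2l; apply: ltn_expl.
have E2 : (X * (P * (x %/ 2 ^ b)) <= x)%N.
  apply: leq_trans (leq_trunc_div x (2 ^ b)).
  rewrite mulnA (mulnC X P) [leqRHS]mulnC leq_mul2r HX1 ?orbT //; lia.
have ndvd (z : int) p : z != 0 -> (`|z| < D)%N -> (P <= p)%N -> ~~ (p %| z)%Z.
  move=> z0 zD Pp; rewrite dvdzE /= gtnNdvd ?absz_gt0 //.
  exact: leq_trans zD (leq_trans DP Pp).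
have HT : (\sum_(P <= p < x.+1 | prime p)
     trunc_log 2 p * (c p + 2 * (x %/ p ^ 2)))%N%:R <=
  (3 * (2 * C * (5 * (1 - q)^-1 + 1) + 4) + 2) * x%:R :> R.
  apply: (@weighted_sum_bound R C q x X P c (good_prime N)) => //.
  - by lra.
  - by rewrite Xx xX.
  - move=> p pp /andP[Pp px] gp.
    apply: (count_zeros_le C0 q2 q1 pp px Xx) => l h' lw.
    apply: (recurrence_zeros_mod h' HC k0 ur NP pp).
    + by apply: ndvd ak _ Pp; rewrite /D; lia.
    + by apply: ndvd un _ Pp; rewrite /D; lia.
    + by move=> d; exact: (good_primeP pp gp lw).
  - move=> p /andP[p0 px].
    (* The index m = 0 is counted too; as p <= x, the extra 1 is absorbed by doubling. *)
    apply: (@le_trans _ _ (2 * (x %/ p))%N%:R).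
      rewrite ler_nat; apply: (@leq_trans (\sum_(0 <= m < (x %/ p).+1) 1)%N).
        by apply: leq_sum => m _; case: (Z p m).
      rewrite sum_nat_const_nat subn0 muln1 mul2n -addnn -addn1 leq_add2l.
      by rewrite divn_gt0.
    rewrite natrM ler_wpM2l // ler_pdivlMr ?ltr0n // -natrM ler_nat.
    exact: leq_trunc_div.
  - have hD : (2 * h <= D)%N by rewrite /D; lia.
    exact: (bad_prime_sum R x D0 hD (leqnn _) NB).
set K := 3 * _ + 2 in HT *; rewrite -(ler_nat R) => /le_trans; apply.
rewrite natrD (natrM R 8) natrD [leRHS]mulrDl -mulrA; apply: lerD; last by rewrite ler_pM2l.
by rewrite mulrDl !mul1r; apply: lerD; rewrite ler_nat.
Qed.

Theorem theorem1 (R : realType) (k : nat) (hk : (2 <= k)%N) :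
  exists c0 : R, 0 < c0 /\
  forall (a : nat -> int) (u : nat -> int) (alpha A : 'I_k -> R[i]),
    a k != 0 ->
    linear_recurrence k a u ->
    injective alpha ->
    (forall i : 'I_k, root (map_poly intr (char_poly_rec k a)) (alpha i)) ->
    (forall i : 'I_k, in_generated_field alpha (A i)) ->
    (forall n : nat, (u n)%:~R = \sum_(i < k) A i * alpha i ^+ n) ->
    (forall i : 'I_k, A i != 0) ->
    nondegenerate_roots alpha ->
    exists x0 : R, forall x : R, x0 <= x ->
      (count_upto (self_divisors u) x)%:R <= c0 * (x / ln x).
Proof.
have k0 : (0 < k)%N by apply: ltnW.
(* Both constants are fixed before the sequence is introduced, so [c0] depends on k only. *)
have [C [q [C0 q2 q1 HC]]] := power_sum_zeros R k.
pose K : R := 2 + 8 * (3 * (2 * C * (5 * (1 - q)^-1 + 1) + 4) + 2).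
have K0 : 0 < K.
  have : 0 < (1 - q)^-1 by rewrite invr_gt0; lra.
  by rewrite /K => y; nra.
exists (4 * K); split; first by rewrite mulr_gt0.
move=> a u alpha A ak ur inj rt _ uE A0 nd.
pose N d := sval (IntegralDiscriminant.power_diff_prod_int (char_poly_rec k a) k d).
have NP : power_discriminants (char_poly_rec k a) k N.
  by move=> d; exact: svalP (IntegralDiscriminant.power_diff_prod_int (char_poly_rec k a) k d).
have [h NB] := power_diff_prod_growth k0 ak inj rt nd NP.
have [n0 un0] := power_sum_neq0 inj (A0 (Ordinal k0)).
have {}un0 : u n0 != 0 by rewrite -(intr_eq0 R[i]) uE.
have [X0 HX0] := recurrence_count_le C0 q2 q1 HC k0 ur ak un0 NP NB.
exists (2 ^ X0.+1)%:R => x xX0.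
have x1 : 1 < x by apply: lt_le_trans xX0; rewrite ltr1n -[1%N]/(2 ^ 0)%N ltn_exp2l.
have x0 : 0 <= x by lra.
have /andP[nx xn] := truncn_itv x0; set n := Num.truncn x in nx xn *.
have nX0 : (2 ^ X0.+1 <= n)%N by rewrite truncn_ge_nat.
have n1 : (0 < n)%N by apply: leq_trans nX0; rewrite expn_gt0.
pose X := trunc_log 2 n.
have /andP[Xn nX] : (2 ^ X <= n < 2 ^ X.+1)%N by rewrite trunc_logP // trunc_log_ltn.
have XX : (X0 < X)%N by rewrite -ltnS -(ltn_exp2l _ _ (isT : 1 < 2)%N) (leq_ltn_trans nX0).
have := HX0 n X (ltnW XX); rewrite Xn nX => /(_ isT).
rewrite /count_upto -/n -sum1_count natrM -/K.
set S : R := (\sum_(i <- _ | _) _)%:R => HS.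
have Xr : 1 <= X%:R :> R by rewrite ler1n; apply: leq_trans XX.
(* Indeed ln x <= (X + 1) ln 2 <= 2 (X + 1) <= 4 X, the source of the factor 4 in [c0]. *)
have lnx : ln x <= 4 * X%:R.
  apply: (@le_trans _ _ (ln (2 ^+ X.+1))).
    rewrite ler_ln ?posrE ?exprn_gt0 //; last by lra.
    by apply: (le_trans (ltW xn)); rewrite -natrX ler_nat.
  rewrite lnXn // -[leLHS]mulr_natl -(natr1 X); have := @ln_sublinear R 2 (ltr0Sn _ _).
  have X10 : 0 <= X%:R + 1 :> R by lra.
  by move=> /ltW/(ler_wpM2l X10)/le_trans; apply; lra.
have lnx0 : 0 < ln x by apply: ln_gt0.
rewrite mulrA ler_pdivlMr //.
have S0 : 0 <= S by [].
apply: (@le_trans _ _ (S * (4 * X%:R))); first by rewrite ler_wpM2l.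
have : K * n%:R <= K * x by rewrite ler_pM2l.
by move: HS; lra.
Qed.
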